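(* Let $(G,\sigma)$ be a signed graph. For every vertex $v\in V(G)$ we have $$\psi(G,\sigma)-2\le \psi(G-v,\sigma)\le \psi(G,\sigma),$$ where $(G-v,\sigma)$ denotes $G-v$ with the restriction of $\sigma$. Furthermore, both bounds can be attained: there exist signed graphs $(G,\sigma)$ with a vertex $v$ such that $\psi(G-v,\sigma)=\psi(G,\sigma)$, and for every integer $k\ge 3$ there exist a signed graph $(G,\sigma)$ with $\psi(G,\sigma)=k$ and a vertex $v\in V(G)$ with $\psi(G-v,\sigma)=k-2$.
   Context: A signed graph $(G,\sigma)$ is a finite simple graph $G$ with a signature $\sigma:E(G)\to\{-,+\}$; subgraphs inherit the signature. Switching a set $S\subseteq V(G)$ changes the sign of every edge with exactly one end in $S$; two signed graphs on the same underlying graph are equivalent if one is obtained from the other by switching some set of vertices. For $k\ge1$ let $M_k=\{-n,\dots,-1,+1,\dots,+n\}$ if $k=2n$, and $M_k=\{-n,\dots,-1,\pm0,+1,\dots,+n\}$ if $k=2n+1$, where $\pm0$ is a single colour with $-(\pm0)=\pm0$ (so $|M_k|=k$). A $k$-colouring of $(G,\sigma)$ is a map $\phi:V(G)\to M_k$; it is proper if $\phi(u)\ne\sigma(uv)\phi(v)$ for every edge $uv$ (where $\sigma(uv)\phi(v)=\phi(v)$ if $\sigma(uv)=+$ and $-\phi(v)$ otherwise). Let $K_k^*$ be the signed multigraph with vertex set $\{i\ge 0: +i\in M_k\}$ (vertex $0$ standing for colour $\pm0$ when $k$ is odd), in which every two distinct vertices are joined by exactly one positive and one negative edge, and every vertex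 $i\neq0$ carries exactly one negative loop (and there are no other edges/loops). Given a $k$-colouring $\phi$ of $(G,\sigma)$, the reduced signed graph $R(G,\sigma,\phi)$ is obtained by (1) switching every vertex with a negative colour $-i$ and recolouring it $+i$; (2) identifying, for each $i$, all vertices of colour $+i$ (resp. $\pm0$) into a single vertex $i$ (resp. $0$), edges inside a class becoming loops; (3) keeping at most one positive and at most one negative edge (or loop) between any two vertices (or at any vertex). The colouring $\phi$ is complete if $R(G,\sigma,\phi)$ is exactly $K_k^*$. The achromatic number $\psi(G,\sigma)$ is the largest $k\ge1$ such that some signed graph equivalent to $(G,\sigma)$ admits a complete $k$-colouring. *)

(* Defs.v *)
From HB Require Import structures.
From mathcomp Require Import all_boot all_order all_algebra.

Set Implicit Arguments.
Unset Strict Implicit.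
Unset Printing Implicit Defensive.

Import Order.TTheory GRing.Theory Num.Theory.

(* Signs are booleans, with [true] for the sign -. The value of [negative] on
   nonadjacent pairs is junk and is never used. *)
Record signed_graph := SignedGraph {
  vertex :> finType;
  adj : rel vertex;
  negative : rel vertex;
  adj_sym : symmetric adj;
  adj_irr : irreflexive adj;
  negative_sym : symmetric negative
}.

Section Switching.
Variables (G : signed_graph) (S : {set G}).

Definition switch_negative : rel G :=
  fun u v => negative u v (+) ((u \in S) (+) (v \in S)).

Lemma switch_negative_sym : symmetric switch_negative.
Proof. by move=> u v; rewrite /switch_negative negative_sym [(u \in S) (+) _]addbC. Qed.

Definition switch : signed_graph :=
  SignedGraph (@adj_sym G) (@adj_irr G) switch_negative_sym.
End Switching.

Section DelVertex.
Variables (G : signed_graph) (x : G).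

Definition del_adj : rel {u : G | u != x} := fun u v => adj (val u) (val v).
Definition del_negative : rel {u : G | u != x} :=
  fun u v => negative (val u) (val v).

Lemma del_adj_sym : symmetric del_adj.
Proof. by move=> u v; apply: adj_sym. Qed.
Lemma del_adj_irr : irreflexive del_adj.
Proof. by move=> u; apply: adj_irr. Qed.
Lemma del_negative_sym : symmetric del_negative.
Proof. by move=> u v; apply: negative_sym. Qed.

Definition del_vertex : signed_graph :=
  SignedGraph del_adj_sym del_adj_irr del_negative_sym.
End DelVertex.

(* The colours of M_k are integers, the colour ±0 being the integer 0. *)
Definition M (k : nat) : seq int :=
  [seq (- Posz i)%R | i <- iota 1 k./2] ++ (if odd k then [:: 0%R] else [::])
  ++ [seq Posz i | i <- iota 1 k./2].

Definition colouring (G : signed_graph) (k : nat) := {ffun G -> seq_sub (M k)}.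

(* A signed multigraph on W with at most one edge (or loop) of each sign on each
   pair of ends: a vertex set, and a set of edges (ends, sign) where the ends
   are [set i; j], so that a loop at i has ends [set i]. *)
Definition signed_multigraph (W : finType) : Type :=
  {set W} * {set {set W} * bool}.

Definition Kstar_vertices (k : nat) : {set 'I_(k./2).+1} :=
  [set i : 'I_(k./2).+1 | Posz i \in M k].

Definition Kstar (k : nat) : signed_multigraph 'I_(k./2).+1 :=
  (Kstar_vertices k,
   [set e : {set 'I_(k./2).+1} * bool |
     [exists i in Kstar_vertices k, exists j in Kstar_vertices k,
        (e.1 == [set i; j]) && ((i != j) || ((i != ord0) && e.2))]]).

Section Reduced.
Variables (G : signed_graph) (k : nat) (phi : colouring G k).

Definition negative_part : {set G} := [set v | (val (phi v) < 0)%R].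

(* [inord] is faithful here, as every colour c in M_k has |c| <= k./2. *)
Definition colour_class (v : G) : 'I_(k./2).+1 := inord `|val (phi v)|%N.

Definition reduced : signed_multigraph 'I_(k./2).+1 :=
  ([set colour_class v | v : G],
   [set ([set colour_class u; colour_class v],
         @negative (switch negative_part) u v) | u in G, v in adj u]).

Definition complete : bool := reduced == Kstar k.
End Reduced.

(* The signed graphs equivalent to G are the [switch S], for S : {set G}. *)
Definition has_complete (G : signed_graph) (k : nat) : bool :=
  [exists S : {set G}, exists phi : colouring (switch S) k, complete phi].

(* The bound on k loses nothing, see [leq_achromatic]. The value is 0 for the
   graph without vertices, which has no complete k-colouring with k >= 1. *)
Definition achromatic (G : signed_graph) : nat :=
  \max_(k < (2 * #|G|).+1 | (0 < k) && has_complete G k) k.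

Lemma mem_M k (c : int) :
  (c \in M k) = (`|c|%N <= k./2) && (odd k || (c != 0%R)).
Proof.
rewrite /M !mem_cat; apply/idP/idP.
  case/or3P=> [/mapP[i]|H|/mapP[i]].
  - rewrite mem_iota => /andP[i1 i2] ->.
    by rewrite abszN absz_nat -ltnS i2 oppr_eq0 -lt0n i1 orbT.
  - by move: H; case: (odd k) => //; rewrite inE => /eqP ->.
  - rewrite mem_iota => /andP[i1 i2] ->.
    by rewrite absz_nat -ltnS i2 -lt0n i1 orbT.
case/andP=> cn; have [-> /=|c0 _] := eqVneq c 0%R.
  by rewrite orbF => ->; rewrite inE eqxx !orbT.
case: c c0 cn => [n n0 cn|n _ cn].
  apply/or3P/Or33/mapP; exists n => //; rewrite mem_iota add1n ltnS cn andbT.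
  by rewrite lt0n; apply: contra n0 => /eqP ->.
by apply/or3P/Or31/mapP; exists n.+1; rewrite ?NegzE // mem_iota add1n ltnS.
Qed.

Lemma card_Kstar_vertices k : k <= 2 * #|Kstar_vertices k|.
Proof.
have [ok|ek] := boolP (odd k).
  rewrite (_ : Kstar_vertices k = setT) ?cardsT ?card_ord.
    by rewrite -{1}(odd_double_half k) ok -mul2n mulnS leq_add2r.
  by apply/setP=> i; rewrite !inE mem_M ok absz_nat -ltnS ltn_ord.
rewrite (_ : Kstar_vertices k = [set~ ord0]) ?cardsC1 ?card_ord /=.
  by rewrite -{1}(odd_double_half k) (negbTE ek) mul2n.
by apply/setP=> i; rewrite !inE mem_M (negbTE ek) absz_nat -ltnS ltn_ord.
Qed.

Lemma leq_achromatic (G : signed_graph) k :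
  0 < k -> has_complete G k -> k <= achromatic G.
Proof.
move=> k0 cG; have /existsP[S /existsP[phi /eqP E]] := cG.
have kG : k < (2 * #|G|).+1.
  rewrite ltnS (leq_trans (card_Kstar_vertices k)) // leq_mul2l /=.
  have <- : [set colour_class phi v | v : G] = Kstar_vertices k by case: E.
  exact: leq_imset_card.
have kP : (0 < Ordinal kG) && has_complete G (Ordinal kG) by rewrite /= k0.
exact: (bigop.leq_bigmax_cond (F := fun i : 'I_(2 * #|G|).+1 => i : nat) _ kP).
Qed.

Lemma achromatic_has_complete (G : signed_graph) :
  0 < achromatic G -> has_complete G (achromatic G).
Proof.
rewrite /achromatic; elim/big_ind: _ => // [x y hx hy|i /andP[]//].
by case: (leqP x y).
Qed.

(* Main.v *)
Require Import Defs.
From mathcomp Require Import all_boot all_algebra zify.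

Set Implicit Arguments.
Unset Strict Implicit.
Unset Printing Implicit Defensive.

(* A complete k-colouring amounts to a switching together with a partition into
   classes: class 0 (only if k is odd) is independent, the other classes span
   negative edges only and at least one of them, and any two classes are joined
   by edges of both signs. Such a structure on an induced subgraph extends by a
   vertex v without losing colours. If v fits into no class, it sends edges of
   both signs to every class but 0; then {v} is a new class 0 when k is even,
   and when k is odd class 0 together with v, switched so that all edges at v
   inside it are negative, is a new ordinary class. Hence the achromatic number
   is monotone under induced subgraphs, and deleting the whole class of v from
   a complete colouring costs at most two colours.
   For the sharpness of the lower bound, K*_k has m^2 - (k mod 2) edges, where m
   is its number of vertices. A graph with that many edges realising K*_k in
   which all the edges leaving some class other than 0 meet at v loses, with v,
   as many edges as separate K*_k from K*_(k-2). *)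

(** * Complete colourings as partitions into colour classes *)

Lemma set2_eqP (T : finType) (a b c d : T) :
  [set a; b] = [set c; d] -> (a = c /\ b = d) \/ (a = d /\ b = c).
Proof.
move=> E.
have : (a \in [set c; d]) && (b \in [set c; d]) by rewrite -E set21 set22.
have : (c \in [set a; b]) && (d \in [set a; b]) by rewrite E set21 set22.
rewrite !inE => /andP[/orP[]/eqP Ec /orP[]/eqP Ed];
  case/andP=> /orP[]/eqP Ea /orP[]/eqP Eb;
  by (left; split; congruence) || (right; split; congruence).
Qed.

(* A palette of 2 #|W| + o colours is encoded by the type [option W], whose
   element [None] is the colour 0 and is available only if [o] holds. *)
Section Partial.
Variable G : signed_graph.

(** The sign after switching the vertices where [t] holds. *)
Definition sign (t : G -> bool) (x y : G) : bool :=
  negative x y (+) (t x (+) t y).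

Lemma sign_sym t x y : sign t x y = sign t y x.
Proof. by rewrite /sign negative_sym [t x (+) _]addbC. Qed.

(** The palette and loop fields place the reduced graph inside K*_k; the onto and edge fields give
    the reverse inclusion. *)
Record complete_on (W : finType) (o : bool) (D : {set G}) (t : G -> bool)
    (c : G -> option W) : Prop := CompleteOn {
  complete_on_palette : forall x, x \in D -> o || (c x != None);
  complete_on_onto : forall a, o || (a != None) -> exists2 x, x \in D & c x = a;
  complete_on_loop : forall x y, x \in D -> y \in D -> adj x y -> c x = c y ->
    (c x != None) && sign t x y;
  complete_on_edge : forall a b s, o || (a != None) -> o || (b != None) ->
    (a != b) || ((a != None) && s) ->
    exists x y, [/\ x \in D, y \in D, adj x y &
      [/\ c x = a, c y = b & sign t x y = s]]
}.

(** [W] is quantified so that colours can be added or dropped by changing the type. *)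
Definition completable (D : {set G}) (k : nat) : Prop :=
  exists (W : finType) (o : bool) (t : G -> bool) (c : G -> option W),
    complete_on o D t c /\ k = o + #|W|.*2.

End Partial.

Lemma mem_Kstar_vertices k (i : 'I_(k./2).+1) :
  (i \in Kstar_vertices k) = odd k || (i != ord0).
Proof. by rewrite inE mem_M absz_nat -ltnS ltn_ord. Qed.

Lemma mem_Kstar_edges k (i j : 'I_(k./2).+1) s :
  (([set i; j], s) \in (Kstar k).2) =
  [&& i \in Kstar_vertices k, j \in Kstar_vertices k &
      (i != j) || ((i != ord0) && s)].
Proof.
rewrite [LHS]inE; apply/existsP/and3P => [[i']|[Hi Hj Hs]]; last first.
  by exists i; rewrite Hi; apply/existsP; exists j; rewrite Hj eqxx.
case/andP=> Hi /existsP[j' /and3P[Hj /= /eqP/set2_eqP[][-> ->] Hs]] //.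
by split=> //; move: Hs; rewrite [j' == i']eq_sym; case: eqVneq => [->|].
Qed.

Lemma completable_of_has_complete (G : signed_graph) k :
  has_complete G k -> completable [set: G] k.
Proof.
case/existsP=> S /existsP[phi /eqP E].
have /= E1 : [set colour_class phi v | v : G] = Kstar_vertices k by case: E.
have E2 : (reduced phi).2 = (Kstar k).2 by rewrite E.
(* Switching [S] and then the negatively coloured vertices amounts to one switching. *)
pose t x := (x \in S) (+) (x \in negative_part phi).
have signE x y : @negative (switch (negative_part phi)) x y = sign t x y.
  by rewrite /= /switch_negative /= /switch_negative /sign -addbA addbACA.
pose c x := unlift ord0 (colour_class phi x).
pose f (a : option 'I_(k./2)) := oapp (lift ord0) ord0 a.
have fK : cancel f (unlift ord0) by case=> [w|] /=; rewrite ?liftK ?unlift_none.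
have cK x : f (c x) = colour_class phi x by rewrite /f /c; case: unliftP.
have f0 a : (f a != ord0) = (a != None).
  by case: a => [w|] //=; rewrite /f /= eq_sym neq_lift.
have mf a : (f a \in Kstar_vertices k) = odd k || (a != None).
  by rewrite mem_Kstar_vertices f0.
exists 'I_(k./2), (odd k), t, c; split; last first.
  by rewrite card_ord odd_double_half.
split=> [x _|a|x y _ _ xy cxy|a b s Ha Hb Hs].
- by rewrite -mf cK -E1 imset_f.
- by rewrite -mf -E1 => /imsetP[x _ fx]; exists x => //; rewrite /c -fx fK.
- have : ([set colour_class phi x; colour_class phi y], sign t x y)
      \in (reduced phi).2.
    by rewrite -signE; apply/imset2P; exists x y.
  rewrite E2 -!cK -cxy mem_Kstar_edges => /and3P[_ _].
  by rewrite eqxx f0.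
- have : ([set f a; f b], s) \in (Kstar k).2.
    by rewrite mem_Kstar_edges !mf Ha Hb (inj_eq (can_inj fK)) f0.
  rewrite -E2 => /imset2P[x y _ xy [/set2_eqP[][fa fb] sE]].
  + by exists x, y; rewrite /c -fa -fb !fK -signE sE.
  + by exists y, x; rewrite /c -fa -fb !fK sign_sym -signE adj_sym sE.
Qed.

Lemma has_complete_of_completable (G : signed_graph) k :
  completable [set: G] k -> has_complete G k.
Proof.
case=> W [o [t [c [[Hp Ho Hl He] kE]]]].
have ok : odd k = o by rewrite kE oddD odd_double oddb addbF.
have kW : k./2 = #|W| by rewrite kE half_bit_double.
pose f (a : option W) : 'I_(k./2).+1 :=
  inord (oapp (fun w => (enum_rank w).+1) 0 a).
have fE a : f a = oapp (fun w => (enum_rank w).+1) 0 a :> nat.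
  by rewrite inordK //; case: a => //= w; rewrite kW ltnS.
have f_inj : injective f.
  move=> [a|] [b|] /(congr1 val); rewrite /= !fE //= => -[/ord_inj].
  by move/enum_rank_inj->.
have [g fK gK] : bijective f.
  by apply: inj_card_bij => //; rewrite card_option card_ord kW.
have f0 a : (f a != ord0) = (a != None).
  by rewrite -(inj_eq f_inj); congr (_ != _); apply/val_inj; rewrite /= fE.
have mf a : (f a \in Kstar_vertices k) = o || (a != None).
  by rewrite mem_Kstar_vertices f0 ok.
pose S := [set x | t x].
have phiP x : Posz (f (c x)) \in M k.
  by have := Hp x (in_setT x); rewrite -mf inE.
(* Only nonnegative colours are used, so no vertex is switched beyond [S]. *)
pose phi : colouring (switch S) k := [ffun x => SeqSub (phiP x)].
apply/existsP; exists S; apply/existsP; exists phi.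
have ccE x : colour_class phi x = f (c x).
  by rewrite /colour_class ffunE /= inord_val.
have signE x y : @negative (switch (negative_part phi)) x y = sign t x y.
  by rewrite /= /switch_negative /= /switch_negative !inE !ffunE /= !addbF.
apply/eqP; rewrite /reduced [RHS]surjective_pairing; congr (_, _).
  apply/setP=> i; apply/imsetP/idP => [[x _ ->]|].
    by rewrite ccE mf Hp.
  by rewrite -(gK i) mf => /Ho[x _ <-]; exists x; rewrite // ccE.
apply/setP=> -[e s]; apply/imset2P/idP => [[x y _ xy ->]|].
  rewrite signE !ccE mem_Kstar_edges !mf !Hp //= (inj_eq f_inj) f0.
  by case: eqVneq => //= cxy; apply: Hl.
rewrite inE => /existsP[i /andP[Hi /existsP[j /and3P[Hj /= /eqP-> Hs]]]].
move: Hi Hj Hs; rewrite -(gK i) -(gK j) !mf (inj_eq f_inj) f0 => Hi Hj Hs.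
have [x [y [_ _ xy [cx cy sxy]]]] := He _ _ _ Hi Hj Hs.
by exists x y => //; rewrite -sxy -signE !ccE cx cy.
Qed.

Lemma completable_leq_achromatic (G : signed_graph) k :
  completable [set: G] k -> k <= achromatic G.
Proof.
move=> /has_complete_of_completable; case: k => // k; exact: leq_achromatic.
Qed.

(** * Extension by a vertex and monotonicity under induced subgraphs *)

Lemma completable_add (G : signed_graph) (D : {set G}) (v : G) k :
  v \notin D -> completable D k ->
  exists2 k', k <= k' & completable (v |: D) k'.
Proof.
move=> vD [W [o [t [c [[Hp Ho Hl He] kE]]]]].
have neqv x : x \in D -> (x == v) = false.
  by move=> xD; apply: contraNF vD => /eqP <-.
(* First case: [v], switched according to [s], fits into the class of [w]. *)
have [/existsP[w /existsP[s /forall_inP Hw]]|noA] := boolP [exists w : W,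
    exists s : bool, forall y in D, adj v y && (c y == Some w) ==>
      (negative v y (+) (s (+) t y))].
  exists k => //; exists W, o, [eta t with v |-> s], [eta c with v |-> Some w].
  split=> //; split=> [x|a /Ho[x xD <-]|x y|a b r Ha Hb Hr].
  - by rewrite !inE /=; case: eqP => [_ _|_ /=]; [rewrite orbT | apply: Hp].
  - by exists x; rewrite ?inE ?xD ?orbT //= neqv.
  - rewrite !inE /= /sign /=; case: (eqVneq x v) => [->|_] /=.
      case: (eqVneq y v) => [->|_ _ /= yD vy cy]; first by rewrite adj_irr.
      by have := Hw y yD; rewrite vy -cy eqxx.
    case: (eqVneq y v) => [->|_ /= xD yD]; last exact: Hl.
    move=> xD _ xv cx; have := Hw x xD; rewrite adj_sym xv cx eqxx /=.
    by rewrite negative_sym [s (+) _]addbC.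
  - have [x [y [xD yD xy [cx cy sxy]]]] := He _ _ _ Ha Hb Hr.
    by exists x, y; rewrite /sign !inE xD yD !orbT /= !neqv.
(* Giving [v] the switching value [t v (+) s] leaves a positive edge to the class of [w]; under [t]
   this edge has sign [s]. *)
have both s w : exists y, [/\ y \in D, adj v y, c y = Some w &
    negative v y (+) (t v (+) t y) = s].
  move: noA; rewrite negb_exists => /forallP/(_ w).
  rewrite negb_exists => /forallP/(_ (t v (+) s)).
  rewrite negb_forall_in => /exists_inP[y yD].
  rewrite negb_imply => /andP[/andP[vy /eqP cy] ss]; exists y; split=> //.
  by move: ss; case: (t v); case: (t y); case: (negative v y); case: s.
(* Second case: class 0, which is new if [o] is false, can receive [v]. *)
have [/forall_inP H0|] := boolP [forall y in D, adj v y ==> (c y != None)].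
  exists (true + #|W|.*2).
    by rewrite kE leq_add2r; case: (o).
  exists W, true, t, [eta c with v |-> None].
  split=> //; split=> //= [a _|x y|a b r _ _ Hr].
  - case: a => [w|]; last by exists v; rewrite ?inE ?eqxx.
    have [|x xD cx] := Ho (Some w); first by rewrite orbT.
    by exists x; rewrite ?inE ?xD ?orbT ?neqv.
  - rewrite !inE; case: (eqVneq x v) => [->|_] /=.
      case: (eqVneq y v) => [->|_ _ /= yD vy cy]; first by rewrite adj_irr.
      by have := H0 y yD; rewrite vy -cy.
    case: (eqVneq y v) => [->|_ /= xD yD]; last exact: Hl.
    by move=> xD _ xv cx; have := H0 x xD; rewrite adj_sym xv cx.
  - case: a b Hr => [a|] [b|] Hr //.
    + have [||//|x [y [xD yD xy [cx cy sxy]]]] :=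
      He (Some a) (Some b) r; rewrite ?orbT //.
      by exists x, y; rewrite !inE xD yD !orbT !neqv.
    + have [y [yD vy cy sy]] := both r a.
      by exists y, v; rewrite !inE eqxx yD orbT neqv // adj_sym sign_sym.
    + have [y [yD vy cy sy]] := both r b.
      by exists v, y; rewrite !inE eqxx yD orbT neqv.
rewrite negb_forall_in => /exists_inP[y0 y0D].
rewrite negb_imply negbK => /andP[vy0 /eqP cy0].
have oT : o by have := Hp _ y0D; rewrite cy0 orbF.
(* Third case: class 0 is switched so that all its edges to [v] become negative. *)
pose t' x := if x == v then t v else
  if c x == None then ~~ (negative v x (+) t v) else t x.
have t'v : t' v = t v by rewrite /t' eqxx.
have t'0 x : x \in D -> c x = None -> sign t' v x.
  move=> xD cx; rewrite /sign t'v /t' neqv // cx eqxx.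
  by case: (negative v x); case: (t v).
have t'W x w : x \in D -> c x = Some w -> t' x = t x.
  by move=> xD cx; rewrite /t' neqv // cx.
exists (#|W|.+1.*2); first by rewrite kE oT.
exists (option W), false, t', [eta (fun x => Some (c x)) with v |-> Some None].
split; last by rewrite card_option.
split=> //= [x _|a|x y|a b r Ha Hb Hr].
- by case: (x == v).
- case: a => // a _; have [|x xD cx] := Ho a; first by rewrite oT.
  by exists x; rewrite ?inE ?xD ?orbT ?neqv ?cx.
- rewrite !inE; case: (eqVneq x v) => [->|_] /=.
    case: (eqVneq y v) => [->|_ _ /= yD vy [cy]]; first by rewrite adj_irr.
    exact: t'0.
  case: (eqVneq y v) => [->|_ /= xD yD xy [cxy]].
    by move=> xD _ xv [cx]; rewrite sign_sym t'0.
  case/andP: (Hl x y xD yD xy cxy); case cx: (c x) => [w|] //= _.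
  by rewrite /sign (t'W x w) // (t'W y w) // -cxy.
- case: a b Ha Hb Hr => [a|] [b|] // _ _.
  case: a b => [a|] [b|] /= Hr.
  + have [||//|x [y [xD yD xy [cx cy sxy]]]] :=
      He (Some a) (Some b) r; rewrite ?orbT //.
    exists x, y; rewrite !inE xD yD !orbT !neqv // cx cy; split=> //; split=> //.
    by rewrite /sign (t'W x a) // (t'W y b).
  (* Switching inside class 0 may have spoilt its own edges, so both signs are taken from the edges
     at [v]. *)
  + have [y [yD vy cy sy]] := both r a.
    exists y, v; rewrite !inE eqxx yD orbT neqv // adj_sym sign_sym cy.
    by split=> //; split=> //; rewrite /sign t'v (t'W y a).
  + have [y [yD vy cy sy]] := both r b.
    exists v, y; rewrite !inE eqxx yD orbT neqv // cy.
    by split=> //; split=> //; rewrite /sign t'v (t'W y b).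
  + exists v, y0; rewrite !inE eqxx y0D orbT neqv // cy0; split=> //; split=> //.
    by rewrite t'0 // (eqP Hr).
Qed.

(** The missing vertices are added one at a time, without loss of colours. *)
Lemma completable_leq (G : signed_graph) (D : {set G}) k :
  completable D k -> k <= achromatic G.
Proof.
have [n] := ubnP #|~: D|; elim: n D k => // n IHn D k Dn DC.
have [D0|[v]] := set_0Vmem (~: D).
  by apply: completable_leq_achromatic; rewrite -[setT]setC0 -D0 setCK.
rewrite inE => vD; have [k' kk' DC'] := completable_add vD DC.
apply: leq_trans kk' _; apply: IHn DC'.
rewrite setCU setIC -setDE -ltnS; apply: leq_trans Dn.
by rewrite ltnS [leqRHS](cardsD1 v) inE vD.
Qed.

(** * The two bounds for deleting a vertex *)

(** The remaining classes are kept whole, so the edges between them survive; [e] embeds the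
    remaining colours into the old palette. *)
Lemma complete_on_restrict (G G' : signed_graph) (i : G' -> G) (W W' : finType)
    (e : option W' -> option W) (o o' : bool)
    (D : {set G}) (D' : {set G'}) t c c' :
    {mono i : x y / adj x y} -> {mono i : x y / negative x y} ->
    injective e -> e None = None -> (o' -> o) ->
    (forall x, x \in D' ->
       [/\ i x \in D, e (c' x) = c (i x) & o' || (c' x != None)]) ->
    (forall a x, o' || (a != None) -> x \in D -> c x = e a ->
       exists2 x', x' \in D' & i x' = x) ->
  complete_on o D t c -> complete_on o' D' (t \o i) c'.
Proof.
move=> iadj ineg e_inj e0 oo HD HD' [_ Ho Hl He].
have eN a : (e a != None) = (a != None) by rewrite -{1}e0 (inj_eq e_inj).
have eo a : o' || (a != None) -> o || (e a != None).
  by rewrite eN; case/orP=> [/oo->|->]; rewrite ?orbT.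
have cE x a : x \in D' -> c (i x) = e a -> c' x = a.
  by case/HD=> _ <- _ /e_inj.
have signE x y : sign (t \o i) x y = sign t (i x) (i y) by rewrite /sign ineg.
split=> [x /HD[]//|a Ha|x y xD yD xy cxy|a b s Ha Hb Hs].
- have [x xD cx] := Ho _ (eo _ Ha); have [y yD yx] := HD' _ _ Ha xD cx.
  by exists y => //; apply: cE; rewrite ?yx.
- have [[ixD cx _] [iyD cy _]] := (HD _ xD, HD _ yD).
  by rewrite -eN signE cx; apply: Hl; rewrite ?iadj // -cx -cy cxy.
- have [|x [y [xD yD xy [cx cy sxy]]]] := He _ _ s (eo _ Ha) (eo _ Hb).
    by rewrite (inj_eq e_inj) eN.
  have [x' x'D E] := HD' _ _ Ha xD cx; have [y' y'D E'] := HD' _ _ Hb yD cy.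
  exists x', y'; rewrite signE -iadj E E'; split=> //.
  by split=> //; apply: cE; rewrite ?E ?E'.
Qed.

Lemma achromatic_del_vertex_leq (G : signed_graph) (v : G) :
  achromatic (del_vertex v) <= achromatic G.
Proof.
have [->//|] := posnP (achromatic (del_vertex v)).
move=> /achromatic_has_complete/completable_of_has_complete.
move: (achromatic _) => k [W [o [t [c [[Hp Ho Hl He] kE]]]]].
(* At [v], which lies outside the coloured set, the switching and the colour get default values. *)
pose p (x : G) : option (del_vertex v) := insub x.
have pK (x : del_vertex v) : p (val x) = Some x by rewrite /p valK.
apply: (@completable_leq G [set~ v]).
exists W, o, (fun x => oapp t false (p x)), (fun x => obind c (p x)).
have vP x : x \in [set~ v] -> exists x' : del_vertex v, x = val x'.
  by rewrite !inE => xv; exists (Sub x xv).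
have vN (x : del_vertex v) : val x \in [set~ v] by rewrite !inE (valP x).
split=> //; split=> [_ /vP[x ->]|a /Ho[x _ <-]|_ _ /vP[x ->] /vP[y ->] xy|].
- by rewrite pK Hp.
- by exists (val x); rewrite ?pK.
- by rewrite /sign !pK => cxy; apply: Hl cxy.
- move=> a b s Ha Hb Hs.
  have [x [y [_ _ xy [cx cy sxy]]]] := He _ _ _ Ha Hb Hs.
  by exists (val x), (val y); rewrite /sign !pK.
Qed.

Lemma achromatic_del_vertex_geq (G : signed_graph) (v : G) :
  achromatic G - 2 <= achromatic (del_vertex v).
Proof.
have [->//|] := posnP (achromatic G).
move=> /achromatic_has_complete/completable_of_has_complete.
move: (achromatic _) => k [W [o [t [c [Hc kE]]]]].
pose D := [set x : del_vertex v | c (val x) != c v].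
have DP x : c x != c v -> exists2 x' : del_vertex v, x' \in D & val x' = x.
  move=> cx; have xv : x != v by apply: contraNneq cx => ->.
  by exists (Sub x xv); rewrite ?inE.
(* Losing class 0 costs one colour, losing an ordinary class two. *)
case cv: (c v) => [w|]; last first.
  apply: (@leq_trans #|W|.*2); first by rewrite kE; case: (o); lia.
  apply: (@completable_leq (del_vertex v) D).
  exists W, false, (t \o val), (c \o val); split=> //.
  apply: (complete_on_restrict (e := id)) Hc => //.
    by move=> x; rewrite inE cv.
  by move=> a x a0 _ cx; apply: DP; rewrite cx cv.
pose W' := {w' : W | w' != w}.
have W'E : #|{: W'}| = #|W|.-1 by rewrite card_sig cardC1.
pose c' (x : del_vertex v) : option W' := obind insub (c (val x)).
apply: (@leq_trans (o + #|{: W'}|.*2)).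
  have : 0 < #|W| by apply/card_gt0P; exists w.
  by rewrite kE W'E; case: (o); lia.
apply: (@completable_leq (del_vertex v) D).
exists W', o, (t \o val), c'; split=> //.
have c'K x : x \in D -> omap val (c' x) = c (val x).
  rewrite inE cv /c'; case: (c _) => //= w' w'w.
  by rewrite insubT //; apply: contraNneq w'w => ->.
apply: (complete_on_restrict (e := omap val)) (Hc) => //.
- by move=> [a|] [b|] //= [/val_inj->].
- move=> x xD; rewrite c'K //; split=> //.
  have := complete_on_palette Hc (in_setT (val x)); rewrite -(c'K _ xD).
  by case: (c' x).
- move=> [a|] x _ _ cx; apply: DP; rewrite cx cv //=.
  by apply: contraNneq (valP a) => -[/eqP].
Qed.

(** * Counting the edges of K*_k *)

Section EdgeCount.
Variables (W : finType) (o : bool).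

Definition palette : {set option W} := [set a | o || (a != None)].

Lemma card_palette : #|palette| = #|W| + o.
Proof.
rewrite /palette; case: (o) => /=.
  by rewrite addn1 -card_option -[RHS]cardsT; apply: eq_card => a; rewrite !inE.
rewrite addn0 -[RHS]/(#|W|.+1.-1) -card_option -(cardsC1 None).
by apply: eq_card => a; rewrite !inE.
Qed.

(* The edges of K*_k correspond to the ordered pairs of colours other than
   (0, 0): the two orders of a pair of distinct colours give its positive and
   negative edge, and the pair (a, a) gives the negative loop at a. *)
Definition Kstar_pairs (B : {set option W}) : {set option W * option W} :=
  setX B B :\ (None, None).

Lemma card_Kstar_pairs (B : {set option W}) :
  #|Kstar_pairs B| = #|B| ^ 2 - (None \in B).
Proof.
have := cardsD1 (None, None) (setX B B); rewrite cardsX inE /= andbb mulnn => ->.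
by rewrite addKn.
Qed.

(** Each edge of K*_k needs an edge of [G] of its own, and [A] holds every edge of [G] in some
    orientation. *)
Lemma leq_card_edge_cover (G : signed_graph) (D : {set G}) t c (A : {set G * G}) :
  (forall x y : G, adj x y -> ((x, y) \in A) || ((y, x) \in A)) ->
  complete_on o D t (c : G -> option W) -> (#|W| + o) ^ 2 - o <= #|A|.
Proof.
move=> HA [_ _ _ He].
have -> : (#|W| + o) ^ 2 - o = #|Kstar_pairs palette|.
  by rewrite card_Kstar_pairs card_palette inE eqxx orbF.
pose r (a : option W) := enum_rank a : nat.
have r_inj : injective r by move=> a b /ord_inj/enum_rank_inj.
(* Whatever its orientation, a negative edge goes to the pair whose second colour does not have the
   larger rank, a positive edge to the reverse pair. *)
pose g (e : G * G) := if (r (c e.2) <= r (c e.1)) == sign t e.1 e.2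
  then (c e.1, c e.2) else (c e.2, c e.1).
apply: leq_trans (leq_imset_card g A); apply/subset_leq_card/subsetP=> -[a b].
rewrite !inE /= => /andP[ab0 /andP[Ha Hb]].
have [|x [y [_ _ xy [cx cy sxy]]]] := He a b (r b <= r a) Ha Hb.
  case: (eqVneq a b) ab0 => // <-; rewrite leqnn andbT /=.
  by apply: contraNneq => ->.
case/orP: (HA x y xy) => xyA; apply/imsetP.
  by exists (x, y) => //; rewrite /g /= cx cy sxy eqxx.
exists (y, x) => //; rewrite /g /= cx cy sign_sym sxy.
case: eqP => // rab; suff -> : a = b by [].
by apply: r_inj; lia.
Qed.

End EdgeCount.

(** These are edge numbers, as K*_k has [uphalf k] vertices. A further vertex outweighs the
    correction by 1; with equally many vertices, k is odd, l = k + 1, and only the correction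
    disappears. *)
Lemma edge_bound_lt k l : 0 < k -> k < l ->
  uphalf k ^ 2 - odd k < uphalf l ^ 2 - odd l.
Proof.
move=> k0 kl; have [uv|vu] := ltnP (uphalf k) (uphalf l).
  have : (uphalf k).+1 ^ 2 <= uphalf l ^ 2 by rewrite leq_sqr.
  have : 0 < uphalf k by lia.
  rewrite -!mulnn; move: (uphalf k) => u; move: (uphalf l * _) => v.
  by case: (odd k); case: (odd l); nia.
have [-> ok ol] : [/\ uphalf l = uphalf k, odd k & ~~ odd l] by split; lia.
by rewrite ok (negbTE ol) subn0 subn1 ltn_predL sqrn_gt0; lia.
Qed.

Lemma achromatic_leq_edge_cover (G : signed_graph) (A : {set G * G}) k :
    (forall x y : G, adj x y -> ((x, y) \in A) || ((y, x) \in A)) ->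
    0 < k -> #|A| <= uphalf k ^ 2 - odd k ->
  achromatic G <= k.
Proof.
move=> HA k0 Ak; rewrite leqNgt; apply/negP=> kG.
have /achromatic_has_complete : 0 < achromatic G by exact: leq_trans kG.
case/completable_of_has_complete=> W [o [t [c [Hc kE]]]].
move/(leq_card_edge_cover HA) in Hc.
have uE : uphalf (achromatic G) = #|W| + o by rewrite kE; case: (o); lia.
have oE : odd (achromatic G) = o by rewrite kE; case: (o); lia.
by have := edge_bound_lt k0 kG; rewrite uE oE ltnNge (leq_trans Hc Ak).
Qed.

(** * Graphs that lose two colours with one vertex *)

Section Extremal.
Variables (n : nat) (o : bool).
Notation P := (option 'I_n.+1).
Notation pal := (palette 'I_n.+1 o).

(* The vertices are the half-edges: an ordered pair of colours stands for an
   edge of K*_k as in [Kstar_pairs], and the boolean selects one of its ends. *)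
Definition half_edge : finType := (P * P * bool)%type.

Definition end_colour (x : half_edge) : P := if x.2 then x.1.2 else x.1.1.

(** The first end of the loop at colour [Some ord0]; it is the vertex to be deleted. *)
Definition hub : half_edge := (Some ord0, Some ord0, false).

(* All ends of the class of the hub are merged into it, except for the second
   end of its loop. *)
Definition attach (x : half_edge) : half_edge :=
  if (end_colour x == Some ord0) && (x != (Some ord0, Some ord0, true))
  then hub else x.

Definition ends (p : P * P) : half_edge * half_edge :=
  (attach (p, false), attach (p, true)).

Definition ext_adj : rel half_edge := fun x y =>
  [exists p in Kstar_pairs pal, ((x, y) == ends p) || ((y, x) == ends p)].

(** The rank convention of the edge count, under which loops are negative. *)
Definition pair_negative (p : P * P) : bool := enum_rank p.2 <= enum_rank p.1.

(** An unmerged end carries the pair of its edge, a merged one the negative pair of [hub]. No edge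
    has both ends merged into [hub], so the conjunction is the sign of the edge. *)
Definition ext_negative : rel half_edge := fun x y =>
  pair_negative x.1 && pair_negative y.1.

Lemma ext_adjP x y :
  reflect (exists2 p, p \in Kstar_pairs pal & (x, y) = ends p \/ (y, x) = ends p)
    (ext_adj x y).
Proof.
apply: (iffP exists_inP) => -[p pK E]; exists p => //.
  by case/orP: E => /eqP; auto.
by case: E => ->; rewrite eqxx ?orbT.
Qed.

Lemma ext_adj_sym : symmetric ext_adj.
Proof. by move=> x y; apply: eq_existsb => p; rewrite orbC. Qed.

Lemma ext_adj_irr : irreflexive ext_adj.
Proof.
move=> x; apply/negbTE/negP=> /ext_adjP[[i j] _] E.
have {E} [-> /eqP] : (x, x) = ends (i, j) by case: E.
rewrite /attach /end_colour /= !xpair_eqE /= !andbF !andbT.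
have [->|i0] := eqVneq i; have [->|j0] := eqVneq j; rewrite /= ?eqxx //=.
- by rewrite /hub !xpair_eqE andbF.
- by rewrite /hub !xpair_eqE (negbTE i0).
- by rewrite !xpair_eqE andbF.
Qed.

Lemma ext_negative_sym : symmetric ext_negative.
Proof. by move=> x y; rewrite /ext_negative andbC. Qed.

Definition ext_graph := SignedGraph ext_adj_sym ext_adj_irr ext_negative_sym.

Lemma end_colour_attach x : end_colour (attach x) = end_colour x.
Proof. by rewrite /attach; case: ifP => // /andP[/eqP-> _]. Qed.

Lemma ext_negative_ends p : ext_negative (ends p).1 (ends p).2 = pair_negative p.
Proof.
have hubN : pair_negative hub.1 by rewrite /pair_negative leqnn.
case: p => i j; rewrite /ext_negative /ends /= /attach /=.
case: ifP => [/andP[/eqP Ei _]|_]; case: ifP => [/andP[/eqP Ej /negP E]|_];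
  rewrite ?hubN ?andbT ?andbb //=.
by rewrite /end_colour /= in Ei Ej; case: E; rewrite Ei Ej.
Qed.

Lemma ext_complete_on :
  @complete_on ext_graph 'I_n.+1 o [set x | end_colour x \in pal]
    (fun=> false) end_colour.
Proof.
have edgeP p : p \in Kstar_pairs pal ->
    [/\ p.1 \in pal, p.2 \in pal & p != (None, None)].
  by case: p => i j; rewrite in_setD1 in_setX => /andP[? /andP[]].
have signE p :
    @sign ext_graph (fun=> false) (ends p).1 (ends p).2 = pair_negative p.
  by rewrite /sign /= !addbF ext_negative_ends.
have colE p : (end_colour (ends p).1 = p.1) * (end_colour (ends p).2 = p.2).
  by rewrite /= !end_colour_attach.
split=> [x|a Ha|x y _ _ xy cxy|a b s Ha Hb Hs].
- by rewrite !inE.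
- by exists (a, a, false); rewrite ?inE.
- have /ext_adjP[p pK Ep] := xy.
  have [_ _ p0] := edgeP _ pK; have [c1 c2] := colE p; have sp := signE p.
  have Ecol : p.1 = p.2 by case: Ep => Ep; rewrite -c1 -c2 -Ep /= cxy.
  have -> : @sign ext_graph (fun=> false) x y = pair_negative p.
    by case: Ep => Ep; rewrite -sp -Ep //= sign_sym.
  rewrite /pair_negative Ecol leqnn andbT.
  have -> : end_colour x = p.1.
    by case: Ep => Ep; rewrite -c1 -Ep.
  by apply: contraNneq p0 => E0; rewrite [p]surjective_pairing -Ecol E0.
- have pK : ((a, b) \in Kstar_pairs pal) && ((b, a) \in Kstar_pairs pal).
    rewrite !in_setD1 !in_setX !inE /= Ha Hb /= !xpair_eqE.
    by case: a b {Ha Hb} Hs => [a|] [b|].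
  case/andP: pK => pab pba.
  (* If (a, b) has the wrong sign, then a and b differ and (b, a) has the right one. *)
  have [sE|sE] := eqVneq s (pair_negative (a, b)).
    exists (ends (a, b)).1, (ends (a, b)).2; split; rewrite ?inE ?colE //.
    - by apply/ext_adjP; exists (a, b) => //; left.
    - by rewrite signE sE.
  have ab : a != b.
    apply: contraNneq sE => Eab; move: Hs; rewrite Eab eqxx /= => /andP[_ ->].
    by rewrite /pair_negative leqnn.
  exists (ends (b, a)).2, (ends (b, a)).1; split; rewrite ?inE ?colE //.
  - by apply/ext_adjP; exists (b, a) => //; right.
  - split=> //; rewrite sign_sym signE; move: sE; rewrite /pair_negative /=.
    have : enum_rank a != enum_rank b :> nat.
      by rewrite (inj_eq val_inj) (inj_eq enum_rank_inj).
    by case: s {Hs} => /=; case: ltngtP.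
Qed.

Lemma achromatic_ext_graph : achromatic ext_graph = o + n.+1.*2.
Proof.
have uphalfE : uphalf (o + n.+1.*2) = n.+1 + o by case: (o); lia.
have oddE : odd (o + n.+1.*2) = o by case: (o); lia.
apply/eqP; rewrite eqn_leq; apply/andP; split; last first.
  apply: completable_leq; exists 'I_n.+1, o, (fun=> false), end_colour.
  by split; [exact: ext_complete_on | rewrite card_ord].
apply: (@achromatic_leq_edge_cover ext_graph (ends @: Kstar_pairs pal)).
- by move=> x y /ext_adjP[p pK []->]; rewrite imset_f ?orbT.
- by rewrite addn_gt0 orbT.
- rewrite uphalfE oddE; apply: leq_trans (leq_imset_card _ _) _.
  by rewrite card_Kstar_pairs card_palette card_ord inE eqxx orbF.
Qed.

(** The surviving edges come from pairs over the other colours, so they are at most as many as the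
    edges of K*_(k-2). *)
Lemma achromatic_ext_graph_del : 0 < o + n ->
  achromatic (del_vertex (hub : ext_graph)) <= o + n.*2.
Proof.
move=> on0.
have uphalfE : uphalf (o + n.*2) = n + o by case: (o); lia.
have oddE : odd (o + n.*2) = o by case: (o); lia.
pose B := pal :\ Some ord0.
pose A := [set e : del_vertex (hub : ext_graph) * del_vertex (hub : ext_graph) |
  (val e.1, val e.2) \in ends @: Kstar_pairs B].
apply: (@achromatic_leq_edge_cover (del_vertex (hub : ext_graph)) A); first 1 last.
- by case: (o) on0; lia.
- rewrite uphalfE oddE.
  have -> : (n + o) ^ 2 - o = #|Kstar_pairs B|.
    have := cardsD1 (Some ord0) pal; rewrite card_palette card_ord inE orbT.
    by rewrite card_Kstar_pairs !inE orbF addSn add1n => -[->].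
  apply: leq_trans (leq_imset_card ends _).
  rewrite -(card_imset (mem A) (f := fun e => (val e.1, val e.2))); last first.
    by move=> [a b] [a' b'] /= [/val_inj-> /val_inj->].
  by apply/subset_leq_card/subsetP=> _ /imsetP[e eA ->]; move: eA; rewrite inE.
(* A pair containing [Some ord0] always has an end merged into [hub], the loop its first one. *)
have inB p : p \in Kstar_pairs pal -> (ends p).1 != hub -> (ends p).2 != hub ->
    p \in Kstar_pairs B.
  case: p => i j; rewrite /ends !in_setD1 !in_setX !in_setD1 /=.
  case/andP=> -> /andP[-> ->].
  rewrite /attach /end_colour /= !andbT !xpair_eqE /= !andbF /= !andbT.
  have [->|i0] := eqVneq i; rewrite ?eqxx //=.
  by have [->|j0] := eqVneq j; rewrite ?(negbTE i0) ?eqxx.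
move=> x y /ext_adjP[p pK] [] E; apply/orP; [left|right];
  by rewrite inE /= E imset_f // inB // -E /= (valP x, valP y).
Qed.

End Extremal.

(** * Edgeless graphs for the upper bound, and the conclusion *)

Lemma achromatic_edgeless (G : signed_graph) (x : G) :
  (forall y z : G, ~~ adj y z) -> achromatic G = 1.
Proof.
move=> noE; apply/eqP; rewrite eqn_leq; apply/andP; split.
  (* K*_1 has no edges, so an empty cover suffices. *)
  apply: (@achromatic_leq_edge_cover _ set0) => //.
    by move=> y z; rewrite (negbTE (noE y z)).
  by rewrite cards0.
apply: (@completable_leq G [set: G]).
(* All vertices form class 0. *)
exists void, true, (fun=> false), (fun=> None); split; last by rewrite card_void.
split=> // [[[]|] _|y z _ _|[[]|] [[]|]] //; first by exists x.
by rewrite (negbTE (noE y z)).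
Qed.

(** Two vertices, since deleting an only vertex would leave achromatic number 0. *)
Definition edgeless : signed_graph :=
  @SignedGraph bool (fun _ _ => false) (fun _ _ => false)
    (fun _ _ => erefl) (fun _ => erefl) (fun _ _ => erefl).

Theorem theorem3p2 :
  (forall (G : signed_graph) (v : G),
      achromatic G - 2 <= achromatic (del_vertex v) <= achromatic G)
  /\ (exists (G : signed_graph) (v : G),
        achromatic (del_vertex v) = achromatic G)
  /\ (forall k : nat, 3 <= k ->
        exists (G : signed_graph) (v : G),
          achromatic G = k /\ achromatic (del_vertex v) = k - 2).
Proof.
split=> [G v|]; last split.
- by rewrite achromatic_del_vertex_geq achromatic_del_vertex_leq.
- exists edgeless, true; rewrite (@achromatic_edgeless edgeless true) //.
  exact: (@achromatic_edgeless _ (Sub false isT : del_vertex (true : edgeless))).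
(* There are [n.+1] ordinary classes, and k >= 3 ensures [0 < o + n]. *)
- move=> k k3; pose n := k./2.-1; pose o := odd k.
  have kE : k = o + n.+1.*2 by rewrite /o /n; lia.
  exists (ext_graph n o), (hub n); rewrite achromatic_ext_graph -kE; split=> //.
  apply/eqP; rewrite eqn_leq.
  have := achromatic_del_vertex_geq (hub n : ext_graph n o).
  rewrite achromatic_ext_graph -kE => ->; rewrite andbT.
  apply: leq_trans (achromatic_ext_graph_del _) _; lia.
Qed.
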